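(* Let $f, g\in\mathbb{R}[x_1,\dots,x_n]$ be polynomials, each of which has distinct principal variances. Let $(\lambda_f,V_f)$ be a PW-PCA of $f$ and let $(\lambda_g,V_g)$ be a PW-PCA of $g$. Put $\hat f = V_f\bullet f$ and $\hat g = V_g\bullet g$, i.e. $\hat f(x)=f(V_fx)$ and $\hat g(x)=g(V_gx)$. Then: (C1) $f\sim_{O(n)} g \implies \lambda_f=\lambda_g$. (C2) $f\sim_{O(n)} g \iff \hat f\sim_{\pm(n)}\hat g$. (C3) For every $\sigma\in\{-1,1\}^n$: if $\sigma\bullet\hat f=\hat g$, then $R\bullet f=g$, where $R=V_f\operatorname{diag}(\sigma)V_g^\top$.
   Context: Orthogonal action and equivalence: $O(n)=\{R\in\mathbb{R}^{n\times n}: R^\top R=I_n\}$. For $R\in O(n)$ and $p\in\mathbb{R}[x_1,\dots,x_n]$, $(R\bullet p)(x)=p(Rx)$. Write $f\sim_{O(n)}g$ if there is $R\in O(n)$ with $g=R\bullet f$. Signflip action and equivalence: $\pm(n)=\{-1,1\}^n$. For $\sigma\in\pm(n)$ and $p\in\mathbb{R}[x_1,\dots,x_n]$, $(\sigma\bullet p)(x)=p(\operatorname{diag}(\sigma)x)$. Write $f\sim_{\pm(n)}g$ if there is $\sigma\in\pm(n)$ with $g=\sigma\bullet f$. Polynomial-weighted variance: for a homogeneous polynomial $h\in\mathbb{R}[x_1,\dots,x_N]$ and $w\in\mathbb{R}^N$, $\operatorname{Var}_w(h)=\int_{\mathbb{S}^{N-1}} h(x)^2\,(w^\top x)^2\,d\mu(x)$,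 where $\mu$ is the (unnormalized surface) spherical measure on the unit sphere $\mathbb{S}^{N-1}\subset\mathbb{R}^N$. Homogenization: for $f\in\mathbb{R}[x_1,\dots,x_n]$, $\overline f(x_1,\dots,x_{n+1})=x_{n+1}^{\deg f}f(x_1/x_{n+1},\dots,x_n/x_{n+1})$. PW-PCA: vectors $v_1,\dots,v_n\in\mathbb{R}^n$ are a set of principal axes for $f$ if for each $i=1,\dots,n$, $v_i$ maximizes $u\mapsto\operatorname{Var}_{[u,0]}(\overline f)$ over all $u\in\mathbb{R}^n$ with $\|u\|=1$ and $u\perp v_1,\dots,v_{i-1}$ (here $[u,0]\in\mathbb{R}^{n+1}$ is $u$ with a zero appended). The principal variances are $\lambda_i=\operatorname{Var}_{[v_i,0]}(\overline f)$. With $\lambda=(\lambda_1,\dots,\lambda_n)\in\mathbb{R}^n$ and $V\in\mathbb{R}^{n\times n}$ the matrix with columns $v_1,\dots,v_n$, the pair $(\lambda,V)$ is called a PW-PCA of $f$. A polynomial has distinct principal variances if its principal variances satisfy $\lambda_1>\dots>\lambda_n$. *)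

(* Defs.v *)
From HB Require Import structures.
From mathcomp Require Import all_boot all_order all_algebra.
(* The notations of mpoly clash with those of mathcomp-analysis; its names come
   first so that those of mathcomp-analysis (e.g. Measure) take precedence. *)
From mathcomp Require Import -(notations) mpoly.
From mathcomp Require Import all_classical all_reals all_analysis measurable_realfun.

Set Implicit Arguments.
Unset Strict Implicit.
Unset Printing Implicit Defensive.

Import Order.TTheory GRing.Theory Num.Theory.
Import numFieldNormedType.Exports.

Local Open Scope classical_set_scope.
Local Open Scope ring_scope.

Section PolynomialActions.
Variables (R : realType) (n : nat).
Local Notation "''X_' i" := (mpolyX R (mnm1 i))
  (at level 8, i at level 2).
Implicit Types (A : 'M[R]_n) (p f g : mpoly n R).

(* (A . p)(x) = p(A x), by substituting \sum_j A i j * X_j for X_i. *)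
Definition lin_act A p : mpoly n R :=
  comp_mpoly [tuple \sum_(j < n) A i j *: 'X_j | i < n] p.

Lemma lin_actE A p (x : 'cV[R]_n) :
  meval (fun i => x i 0) (lin_act A p) =
  meval (fun i => (A *m x) i 0) p.
Proof.
rewrite /lin_act comp_mpoly_meval; apply: meval_eq => i.
rewrite tnth_mktuple raddf_sum mxE; apply: eq_bigr => j _.
by rewrite /= mevalZ mevalXU.
Qed.

Definition orthogonal_mx A : Prop := A^T *m A = 1%:M.

Definition is_signs (s : 'rV[R]_n) : Prop :=
  forall i, s 0 i = 1 \/ s 0 i = -1.

Definition sim_orth f g : Prop :=
  exists2 A, orthogonal_mx A & g = lin_act A f.

Definition sim_sign f g : Prop :=
  exists2 s, is_signs s & g = lin_act (diag_mx s) f.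

(* The total degree; msize is one more than the degree, and 0 for the zero
   polynomial, which gets degree 0 here (its homogenization is 0 anyway). *)
Definition mdegree p : nat := (mpoly.msize p).-1.

(* The extra variable is X_(rshift n 0), the last of the n + 1 variables. *)
Definition homogenize p : mpoly (n + 1) R :=
  \sum_(m <- msupp p) mcoeff m p *:
    ((\prod_(i < n) 'X_(lshift 1 i) ^+ m i) *
     'X_(rshift n ord0) ^+ (mdegree p - mdeg m)).

Lemma homogenizeE p (x : 'I_(n + 1) -> R) (t := x (rshift n ord0)) :
  t != 0 ->
  meval x (homogenize p) =
  t ^+ mdegree p * meval (fun i => x (lshift 1 i) / t) p.
Proof.
move=> t0; rewrite /homogenize raddf_sum [in RHS]mevalE mulr_sumr.
rewrite !big_seq; apply: eq_bigr => m mp /=.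
rewrite mevalZ mevalM !rmorphXn /= mevalXU rmorph_prod /=.
rewrite [RHS]mulrCA; congr (_ * _).
under eq_bigr do rewrite rmorphXn /= mevalXU.
under [in RHS]eq_bigr do rewrite exprMn exprVn.
rewrite big_split /= prodfV prodrXr -mdegE mulrCA -/t; congr (_ * _).
rewrite expfB_cond // (negbTE t0) add0n -ltnS.
by rewrite (leq_trans (msize_mdeg_lt mp)) // leqSpred.
Qed.

End PolynomialActions.

Section SphereMeasure.
Variable R : realType.
Local Open Scope ereal_scope.

(* N-dimensional Lebesgue measure, as an iterated product measure. *)
Fixpoint lebesgue_tuple N : set (N.-tuple R) -> \bar R :=
  match N with
  | 0 => dirac [tuple]
  | M.+1 => pushforward (@lebesgue_measure R \x @lebesgue_tuple M)
              (fun p => cons_tuple p.1 p.2)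
  end.

Let measurable_cons_tuple M : measurable_fun [set: R * M.-tuple R]
  (fun p => cons_tuple p.1 p.2 : M.+1.-tuple R).
Proof. exact: (@measurable_cons _ _ (R * M.-tuple R)%type R fst M snd). Qed.

Section Step.
Variables (M : nat) (mu : {sigma_finite_measure set (M.-tuple R) -> \bar R}).

Let step : set (M.+1.-tuple R) -> \bar R :=
  pushforward (@lebesgue_measure R \x mu) (fun p => cons_tuple p.1 p.2).

HB.instance Definition _ := Measure.copy step
  (measure_function_pushforward__canonical__measure_function_Measure
     (@lebesgue_measure R \x mu) (@measurable_cons_tuple M)).

Let step_sigma_finite : sigma_finite setT step.
Proof.
have /sigma_finiteP[F [TF ndF Foo]] := sigma_finiteT (@lebesgue_measure R).
have /sigma_finiteP[G [TG ndG Goo]] := sigma_finiteT mu.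
pose split_tuple (t : M.+1.-tuple R) := (thead t, behead_tuple t).
have splitK : cancel (fun p => cons_tuple p.1 p.2) split_tuple.
  by move=> -[x t]; congr (_, _); exact/val_inj.
have msplit : measurable_fun [set: M.+1.-tuple R] split_tuple.
  apply/measurable_fun_pairP; split; first exact: (measurable_tnth ord0).
  exact: measurable_behead.
exists (fun k => split_tuple @^-1` (F k `*` G k)).
  rewrite -preimage_bigcup [X in _ @^-1` X](_ : _ = setT) ?preimage_setT//.
  rewrite -setXTT TF TG; apply/seteqP; split=> -[x t].
    by move=> [k _ [? ?]]; split; exists k.
  move=> [[/= i _ Fx] [j _ Gt]]; exists (maxn i j) => //; split => /=.
    by move: Fx; exact/subsetPset/ndF/leq_maxl.
  by move: Gt; exact/subsetPset/ndG/leq_maxr.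
move=> k; have [mF Fk] := Foo k; have [mG Gk] := Goo k; split.
  by rewrite -[X in measurable X]setTI; apply: msplit => //; exact: measurableX.
rewrite /step /pushforward -comp_preimage.
rewrite (_ : split_tuple \o _ = id) ?preimage_id; last exact/funext.
by rewrite product_measure1E// lte_mul_pinfty// ge0_fin_numE.
Qed.

HB.instance Definition _ :=
  Measure_isSigmaFinite.Build _ _ _ step step_sigma_finite.

Lemma lebesgue_tuple_step :
  {nu : {sigma_finite_measure set (M.+1.-tuple R) -> \bar R} |
    step = nu :> (_ -> _)}.
Proof. by exists step. Qed.

End Step.

Let lebesgue_tuple_measure N :
  {mu : {sigma_finite_measure set (N.-tuple R) -> \bar R} |
    lebesgue_tuple (N := N) = mu :> (_ -> _)}.
Proof.
elim: N => [|M [mu muE]].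
  by exists [the {sigma_finite_measure set _ -> \bar R} of dirac [tuple]].
by rewrite /= muE; exact: lebesgue_tuple_step.
Qed.

Section LebesgueTuple.
Variable N : nat.
Local Notation leb := (@lebesgue_tuple N).

Let leb0 : leb set0 = 0.
Proof. by have [mu ->] := lebesgue_tuple_measure N; exact: measure0. Qed.

Let leb_ge0 A : 0 <= leb A.
Proof. by have [mu ->] := lebesgue_tuple_measure N; exact: measure_ge0. Qed.

Let leb_sigma_additive : semi_sigma_additive leb.
Proof.
by have [mu ->] := lebesgue_tuple_measure N; exact: measure_semi_sigma_additive.
Qed.

HB.instance Definition _ := isMeasure.Build _ _ _ leb
  leb0 leb_ge0 leb_sigma_additive.

Let leb_sigma_finite : sigma_finite setT leb.
Proof. by have [mu ->] := lebesgue_tuple_measure N; exact: sigma_finiteT. Qed.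

HB.instance Definition _ :=
  Measure_isSigmaFinite.Build _ _ _ leb leb_sigma_finite.

End LebesgueTuple.

Section SurfaceMeasure.
Variable N : nat.

Definition tuple_norm (x : N.-tuple R) : R :=
  Num.sqrt (\sum_(i < N) tnth x i ^+ 2)%R.

Definition sphere : set (N.-tuple R) := [set x | tuple_norm x = 1%R].

Definition punctured_ball : set (N.-tuple R) :=
  [set x | (0 < tuple_norm x <= 1)%R].

Definition radial_proj (x : N.-tuple R) : N.-tuple R :=
  [tuple tnth x i / tuple_norm x | i < N]%R.

(* The unnormalized surface measure of a subset A of the unit sphere of R^N,
   through polar coordinates: N times the Lebesgue measure of the cone
   {r a | 0 < r <= 1, a \in A} (so that the whole sphere gets N times the
   volume of the unit ball). *)
Definition surface_measure (A : set (N.-tuple R)) : \bar R :=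
  N%:R%:E * @lebesgue_tuple N (radial_proj @^-1` A `&` punctured_ball).

Let measurable_tuple_norm : measurable_fun [set: N.-tuple R] tuple_norm.
Proof.
apply: (measurableT_comp (f := @Num.sqrt R)).
  by apply: continuous_measurable_fun; exact: sqrt_continuous.
apply: measurable_sum => i; apply: measurable_funX; exact: measurable_tnth.
Qed.

Let measurable_radial_proj : measurable_fun [set: N.-tuple R] radial_proj.
Proof.
apply/measurable_fun_tnthP => i.
rewrite (_ : _ \o _ = fun x => tnth x i * tuple_norm x `^ (-1))%R.
  apply: measurable_funM; first exact: measurable_tnth.
  exact: (measurableT_comp (measurable_powR _)).
by apply/funext => x /=; rewrite tnth_mktuple powR_inv1 ?sqrtr_ge0.
Qed.

Let measurable_punctured_ball : measurable punctured_ball.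
Proof.
rewrite (_ : punctured_ball = tuple_norm @^-1` `]0%R, 1%R]%classic).
  by rewrite -[X in measurable X]setTI; exact: measurable_tuple_norm.
by apply/seteqP; split=> x /=; rewrite in_itv.
Qed.

HB.instance Definition _ := Measure.copy surface_measure
  (mscale (NngNum (ler0n R N))
    (measure_function_pushforward__canonical__measure_function_Measure
       (mrestr (@lebesgue_tuple N) measurable_punctured_ball)
       measurable_radial_proj)).

End SurfaceMeasure.

End SphereMeasure.
Arguments surface_measure R N : clear implicits.
Arguments sphere R N : clear implicits.

Section PrincipalAxes.
Variables (R : realType) (n : nat).
Implicit Types (f : mpoly n R) (u v : 'cV[R]_n) (V : 'M[R]_n).

Definition pw_var N (w : 'cV[R]_N) (h : mpoly N R) : R :=
  \int[surface_measure R N]_(x in sphere R N)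
    (meval (tnth x) h ^+ 2 * (\sum_(i < N) w i 0 * tnth x i) ^+ 2).

Definition dotv u v : R := \sum_(k < n) u k 0 * v k 0.

Definition vnorm u : R := Num.sqrt (dotv u u).

(* The variance of the homogenization in direction [u, 0]. *)
Definition axis_var f u : R := pw_var (col_mx u (0 : 'cV_1)) (homogenize f).

Definition axis_candidate (v : 'I_n -> 'cV[R]_n) (i : 'I_n) u : Prop :=
  vnorm u = 1 /\ forall j : 'I_n, (j < i)%N -> dotv u (v j) = 0.

Definition principal_axes f (v : 'I_n -> 'cV[R]_n) : Prop :=
  forall i, axis_candidate v i (v i) /\
    forall u, axis_candidate v i u -> axis_var f u <= axis_var f (v i).

Definition is_pwpca f (lambda : 'rV[R]_n) V : Prop :=
  principal_axes f (fun i => col i V) /\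
  forall i, lambda 0 i = axis_var f (col i V).

Definition distinct_principal_variances f : Prop :=
  exists lambda V, is_pwpca f lambda V /\
    forall i j : 'I_n, (i < j)%N -> lambda 0 j < lambda 0 i.

End PrincipalAxes.

(* Main.v *)
(* Rotation invariance of the surface measure gives
   axis_var (R . f) u = axis_var f (R u), so R maps principal axes of R . f to
   principal axes of f.  Since u |-> axis_var f u is a quadratic form, its
   principal axes form an orthonormal eigenbasis, unique up to signs when the
   principal variances are distinct.  Hence R V_g = V_f diag(s).
   The invariance itself comes from that of Lebesgue measure, which is scaled
   by |det A|^-1 under preimage by x |-> A x + q: with a nonzero pivot, A is the
   composition of a map changing the first coordinate only and one changing the
   other coordinates only, to both of which Fubini applies. *)
Require Import Defs.
From mathcomp Require Import all_boot all_order all_algebra.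
From mathcomp Require Import -(notations) mpoly.
From mathcomp Require Import all_classical all_reals all_analysis.
From mathcomp Require Import measurable_realfun ring lra.

Set Implicit Arguments.
Unset Strict Implicit.
Unset Printing Implicit Defensive.

Import Order.TTheory GRing.Theory Num.Theory.
Import numFieldNormedType.Exports.

Local Open Scope classical_set_scope.
Local Open Scope ring_scope.

(** * Lebesgue measure under affine maps *)

Section AffineLine.
Variable R : realType.
Local Open Scope ereal_scope.
Implicit Types a b : R.

(** The pushforward multiplied by $|a|$ gives every interval []c, d]] its length, and these
    intervals determine Lebesgue measure. *)
Lemma lebesgue_measure_affine a b (A : set (measurableTypeR R)) :
  a != 0%R -> measurable A ->
  lebesgue_measure
    ((fun x : measurableTypeR R => a * x + b : measurableTypeR R)%R @^-1` A) =
  (`|a|^-1)%:E * lebesgue_measure A.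
Proof.
move=> a0 mA.
pose T (x : measurableTypeR R) : measurableTypeR R := (a * x + b)%R.
have mT : measurable_fun [set: measurableTypeR R] T.
  by apply: measurable_funD => //; apply: measurable_funM.
have mP := isMeasurableFun.Build _ _ _ _ _ mT.
pose P := pushforward (@lebesgue_measure R) T.
pose PM : {measure set (measurableTypeR R) -> \bar R} :=
  measure_function_pushforward__canonical__measure_function_Measure
    (@lebesgue_measure R) mT.
pose mu := mscale (NngNum (normr_ge0 a)) PM.
have muE X : mu X = `|a|%:E * lebesgue_measure (T @^-1` X) by [].
have -> : lebesgue_measure A = mu A.
  apply: lebesgue_measure_unique => // X [[c d] _ <-].
  rewrite [RHS]muE.
  rewrite lebesgue_measure_itv /= lte_fin.
  have [lt0a|gt0a|e0] := ltgtP 0%R a; last by rewrite e0 eqxx in a0.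
  - rewrite [T @^-1` _](_ : _ = `]((c - b) / a)%R, ((d - b) / a)%R]%classic); last first.
      apply/seteqP; split => x; rewrite /= !in_itv/= /T;
      by rewrite ltr_pdivrMr// ler_pdivlMr// ltrBlDr lerBrDr mulrC.
    rewrite lebesgue_measure_itv /= lte_fin ltr_pM2r ?invr_gt0// ltrBlDr subrK.
    case: ifP => _; last by rewrite mule0.
    rewrite -!EFinD -EFinM gtr0_norm//; congr (_%:E).
    by field.
  (* With a negative slope the closed end changes sides; the length does not depend on this. *)
  - rewrite [T @^-1` _](_ : _ = `[((d - b) / a)%R, ((c - b) / a)%R[%classic); last first.
      apply/seteqP; split => x; rewrite /= !in_itv/= /T;
      by rewrite ltr_ndivlMr// ler_ndivrMr// ltrBlDr lerBrDr mulrC andbC.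
    rewrite lebesgue_measure_itv /= lte_fin ltr_nM2r ?invr_lt0// ltrBlDr subrK.
    case: ifP => _; last by rewrite mule0.
    rewrite -!EFinD -EFinM ltr0_norm//; congr (_%:E).
    by field.
by rewrite [X in _ * X]muE muleA -EFinM mulVf ?normr_eq0// mul1e.
Qed.

End AffineLine.

(** * Slicing along the first coordinate *)

Section TupleFubini.
Variables (R : realType) (M : nat).
Local Open Scope ereal_scope.
Local Notation leb := (@lebesgue_tuple R).

Let cons_fun (p : measurableTypeR R * M.-tuple R) : M.+1.-tuple R :=
  cons_tuple p.1 p.2.

Let measurable_cons_fun :
  measurable_fun [set: measurableTypeR R * M.-tuple R] cons_fun.
Proof.
exact: (@measurable_cons _ _ (measurableTypeR R * M.-tuple R)%type R fst M snd).
Qed.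

Let measurable_cons_preimage (A : set (M.+1.-tuple R)) :
  measurable A -> measurable (cons_fun @^-1` A).
Proof.
by move=> mA; rewrite -[X in measurable X]setTI; exact: measurable_cons_fun.
Qed.

Lemma lebesgue_tuple_xsection (A : set (M.+1.-tuple R)) :
  leb A = \int[lebesgue_measure]_x leb [set t : M.-tuple R | A (cons_tuple x t)].
Proof.
rewrite /= /pushforward /product_measure1; apply: eq_integral => x _ /=.
by congr (leb _); apply/seteqP; split => t; rewrite /xsection /= inE.
Qed.

(** Integrating in the opposite order gives the same value on rectangles, hence the same measure by
    uniqueness of the product measure. *)
Lemma lebesgue_tuple_ysection (A : set (M.+1.-tuple R)) : measurable A ->
  leb A = \int[leb (N:=M)]_t lebesgue_measure [set x | A (cons_tuple x t)].
Proof.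
move=> mA.
transitivity ((lebesgue_measure \x^ leb (N := M)) (cons_fun @^-1` A)).
  refine (@product_measure_unique _ _ _ _ R lebesgue_measure (leb (N := M))
    _ _ _ _); last exact: measurable_cons_preimage.
  by move=> B C mB mC; exact: product_measure2E.
apply: eq_integral => x _ /=.
by congr (lebesgue_measure _); apply/seteqP; split => t;
  rewrite /ysection /= inE.
Qed.

(** Every slice with fixed head is scaled by [k], hence so is the integral over heads. Letting [psi]
    depend on the head allows shears. *)
Lemma lebesgue_tuple_scale_tail (psi : R -> M.-tuple R -> M.-tuple R) (k : R)
    (T : M.+1.-tuple R -> M.+1.-tuple R) (A : set (M.+1.-tuple R)) :
  (0 <= k)%R ->
  (forall x t, T (cons_tuple x t) = cons_tuple x (psi x t)) ->
  (forall x B, measurable B -> leb (psi x @^-1` B) = k%:E * leb B) ->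
  measurable A -> leb (T @^-1` A) = k%:E * leb A.
Proof.
move=> k0 TE psiE mA; have mA' := measurable_cons_preimage mA.
have sectE x : [set t | A (cons_tuple x t)] = xsection (cons_fun @^-1` A) x.
  by apply/seteqP; split => t; rewrite /xsection /= inE.
rewrite !lebesgue_tuple_xsection -ge0_integralZl//; last first.
  under eq_fun do rewrite sectE.
  exact: measurable_fun_xsection.
apply: eq_integral => x _; rewrite -(psiE x); last first.
  by rewrite sectE; exact: measurable_xsection.
by congr (leb _); apply/seteqP; split => t /=; rewrite TE.
Qed.

(** The same argument with slices of fixed tail, available because the order of integration can be
    exchanged. *)
Lemma lebesgue_tuple_scale_head (phi : M.-tuple R -> R -> R) (k : R)
    (T : M.+1.-tuple R -> M.+1.-tuple R) (A : set (M.+1.-tuple R)) :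
  (0 <= k)%R -> measurable_fun setT T ->
  (forall x t, T (cons_tuple x t) = cons_tuple (phi t x) t) ->
  (forall t (B : set (measurableTypeR R)), measurable B ->
     lebesgue_measure (phi t @^-1` B) = k%:E * lebesgue_measure B) ->
  measurable A -> leb (T @^-1` A) = k%:E * leb A.
Proof.
move=> k0 mT TE phiE mA; have mA' := measurable_cons_preimage mA.
have sectE t : [set x : measurableTypeR R | A (cons_tuple x t)] =
    ysection (cons_fun @^-1` A) t.
  by apply/seteqP; split => x; rewrite /ysection /= inE.
rewrite !lebesgue_tuple_ysection// -?ge0_integralZl//; last 2 first.
  - rewrite (_ : (fun t => _) = lebesgue_measure \o ysection (cons_fun @^-1` A)).
      exact: measurable_fun_ysection.
    by apply/funext => t /=; rewrite -sectE.
  - by rewrite -[X in measurable X]setTI; exact: mT.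
apply: eq_integral => t _; rewrite -(phiE t); last first.
  by rewrite sectE; exact: measurable_ysection.
by congr (lebesgue_measure _); apply/seteqP; split => x /=; rewrite TE.
Qed.

End TupleFubini.

(** * Affine maps and the determinant *)

Section TupleAffine.
Variable R : realType.
Implicit Types N M : nat.

Definition tuple_col N (x : N.-tuple R) : 'cV[R]_N := \col_i tnth x i.

Definition tuple_affine N (A : 'M[R]_N) (q : 'cV[R]_N) (x : N.-tuple R) :
  N.-tuple R := [tuple (A *m tuple_col x + q) i 0 | i < N].

Lemma tuple_col_inj N : injective (@tuple_col N).
Proof.
move=> x y /colP xy; apply: eq_from_tnth => i.
by have := xy i; rewrite !mxE.
Qed.

Lemma tuple_col_affine N A q (x : N.-tuple R) :
  tuple_col (tuple_affine A q x) = A *m tuple_col x + q.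
Proof. by apply/colP => i; rewrite mxE tnth_mktuple. Qed.

Lemma tuple_affine_comp N A B q r (x : N.-tuple R) :
  tuple_affine A q (tuple_affine B r x) =
  tuple_affine (A *m B) (A *m r + q) x.
Proof.
by apply: tuple_col_inj; rewrite !tuple_col_affine mulmxDr mulmxA addrA.
Qed.

Lemma tuple_col_cons M (x : R) (t : M.-tuple R) :
  tuple_col (cons_tuple x t) = col_mx x%:M (tuple_col t) :> 'cV[R]_(1 + M).
Proof.
apply/colP => i; case: (split_ordP i) => j ->.
  by rewrite col_mxEu !mxE ord1 eqxx mulr1n lshift0 tnth0.
by rewrite col_mxEd !mxE rshift1 tnthS.
Qed.

(** With [c = 0], [D = 1] and [q = 0] only the head moves; with [a = 1], [b = 0] and [p = 0] only
    the tail does. *)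
Lemma tuple_affine_cons M a b c (D : 'M[R]_M) p q x (t : M.-tuple R) :
  tuple_affine (block_mx a%:M b c D) (col_mx p%:M q) (cons_tuple x t) =
  cons_tuple (a * x + ((b *m tuple_col t) 0 0 + p))
    (tuple_affine D (x *: c + q) t) :> M.+1.-tuple R.
Proof.
apply: tuple_col_inj; rewrite tuple_col_affine !tuple_col_cons.
transitivity (block_mx a%:M b c D *m col_mx x%:M (tuple_col t) + col_mx p%:M q).
  by [].
rewrite mul_block_col add_col_mx tuple_col_affine mul_scalar_mx mul_mx_scalar.
rewrite -[x *: c + _ + q]addrA addrCA.
rewrite [X in col_mx X _](_ : _ = (a * x + ((b *m tuple_col t) 0 0 + p))%:M) //.
by apply/colP => i; rewrite !ord1 !mxE eqxx !mulr1n addrA.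
Qed.

Lemma measurable_tuple_affine N (A : 'M[R]_N) q :
  measurable_fun setT (tuple_affine A q).
Proof.
apply/measurable_fun_tnthP => i.
rewrite (_ : _ \o _ = fun x => \sum_j A i j * tnth x j + q i 0).
  apply: measurable_funD => //; apply: measurable_sum => j.
  by apply: measurable_funM => //; exact: measurable_tnth.
apply/funext => x /=; rewrite tnth_mktuple !mxE; congr (_ + _).
by apply: eq_bigr => j _; rewrite mxE.
Qed.

Lemma measurable_affine_preimage N (A : 'M[R]_N) q (B : set (N.-tuple R)) :
  measurable B -> measurable (tuple_affine A q @^-1` B).
Proof.
by move=> mB; rewrite -[X in measurable X]setTI; exact: measurable_tuple_affine.
Qed.

Local Notation leb := (@lebesgue_tuple R).

(** The translation [q] is universally quantified because fixing one coordinate of a linear map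
    leaves an affine map of the others, whose offset varies with the slice. *)
Let scales N (A : 'M[R]_N) := forall q (B : set (N.-tuple R)), measurable B ->
  leb (tuple_affine A q @^-1` B) = ((`|\det A|^-1)%:E * leb B)%E.

Let scales_mul N (A B : 'M[R]_N) : scales A -> scales B -> scales (A *m B)%R.
Proof.
move=> sA sB q X mX.
rewrite (_ : _ @^-1` X = tuple_affine B 0 @^-1` (tuple_affine A q @^-1` X)).
  rewrite sB ?sA//; last exact: measurable_affine_preimage.
  by rewrite muleA -EFinM det_mulmx normrM invfM mulrC.
by apply/seteqP; split => x /=; rewrite tuple_affine_comp mulmx0 add0r.
Qed.

(** Block elimination gives [A = A2 *m A1], where [A1] moves only the head, with slope [a], and [A2]
    moves only the tail, through [D]. *)
Let scales_pivot M (A : 'M[R]_(1 + M)) :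
  (forall D : 'M[R]_M, D \in unitmx -> scales D) ->
  A \in unitmx -> (A : 'M[R]_M.+1) 0 0 != 0 -> scales A.
Proof.
move=> IH uA a0; set a := (A : 'M[R]_M.+1) 0 0 in a0.
pose b : 'M[R]_(1, M) := ursubmx A; pose c : 'M[R]_(M, 1) := dlsubmx A.
(* The Schur complement of the pivot, so that $\det A = a \det D$. *)
pose D := (drsubmx A - a^-1 *: c *m b)%R.
pose A1 : 'M[R]_(1 + M) := block_mx a%:M b 0 1%:M.
pose A2 : 'M[R]_(1 + M) := block_mx 1%:M 0 (a^-1 *: c) D.
have AE : A = A2 *m A1.
  rewrite mulmx_block !mul1mx !mul0mx !mulmx0 !addr0 mulmx1.
  rewrite mul_mx_scalar scalerA divff// scale1r /D addrC subrK.
  by rewrite -[LHS]submxK [ulsubmx A]mx11_scalar !mxE lshift0.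
have [dA1 dA2] : \det A1 = a /\ \det A2 = \det D.
  by rewrite det_ublock det_lblock !det1 det_scalar1 mulr1 mul1r.
have uD : D \in unitmx.
  by move: uA; rewrite AE unitmx_mul => /andP[+ _]; rewrite !unitmxE dA2.
move=> q X mX.
(* The translation is split too: [r] takes the head of [q], and [p] corrects the tail for what [A2]
   does to [r]. *)
pose q0 := usubmx (q : 'cV[R]_(1 + M)).
pose r : 'cV[R]_(1 + M) := col_mx (q0 0 0)%:M 0.
pose p : 'cV[R]_M := (dsubmx (q : 'cV[R]_(1 + M)) - a^-1 *: c *m q0)%R.
have qE : q = (A2 *m r + col_mx 0%:M p)%R.
  rewrite mul_block_col mul1mx !mulmx0 !addr0 add_col_mx -mx11_scalar.
  by rewrite raddf0 addr0 addrC subrK vsubmxK.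
rewrite (_ : _ @^-1` X =
  tuple_affine A1 r @^-1` (tuple_affine A2 (col_mx 0%:M p) @^-1` X)); last first.
  by apply/seteqP; split => x /=; rewrite tuple_affine_comp -AE -qE.
rewrite (@lebesgue_tuple_scale_head _ _
  (fun t x => a * x + ((b *m tuple_col t) 0 0 + q0 0 0))%R `|a|^-1).
- rewrite (@lebesgue_tuple_scale_tail _ _
    (fun x => tuple_affine D (x *: (a^-1 *: c) + p)%R) `|\det D|^-1) ?invr_ge0//.
  + by rewrite muleA -EFinM AE det_mulmx dA1 dA2 normrM invfM mulrC.
  + move=> x t; rewrite [LHS]tuple_affine_cons mul0mx mxE !addr0 mul1r.
    by [].
  + by move=> x B mB; exact: IH.
- by rewrite invr_ge0.
- exact: measurable_tuple_affine.
- move=> x t; rewrite [LHS]tuple_affine_cons scaler0 addr0; congr cons_tuple.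
  by apply: tuple_col_inj; rewrite tuple_col_affine mul1mx addr0.
- by move=> t B mB; exact: lebesgue_measure_affine.
- exact: measurable_affine_preimage.
Qed.

(* A vanishing pivot is made nonzero by adding a row with nonzero first entry
   to the first row; the inverse row operation again has a nonzero pivot. *)
Lemma lebesgue_tuple_affine N (A : 'M[R]_N) q (B : set (N.-tuple R)) :
  A \in unitmx -> measurable B ->
  leb (tuple_affine A q @^-1` B) = ((`|\det A|^-1)%:E * leb B)%E.
Proof.
move=> uA; move: q B; change (scales A); elim: N A uA => [|M IH] A uA.
  move=> q B _; rewrite det_mx00 normr1 invr1 mul1e.
  congr (leb _); apply/seteqP; split => x /=;
  by rewrite [tuple_affine _ _ _]tuple0 [x]tuple0.
have [a0|a0] := eqVneq (A 0 0) 0; last exact: (@scales_pivot M).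
have [i Ai0] : exists i, A i 0 != 0.
  apply/existsP; apply: contraT; rewrite negb_exists => /forallP A0.
  move: uA; rewrite unitmxE (expand_det_col _ 0) big1 ?unitr0// => j _.
  by have /negPn/eqP -> := A0 j; rewrite mul0r.
have i0 : i != 0 by apply: contraNneq Ai0 => ->; rewrite a0.
pose S c : 'M[R]_M.+1 := (1%:M + c *: delta_mx 0 i)%R.
have S00 c : S c 0 0 = 1.
  by rewrite !mxE [0 == i]eq_sym (negbTE i0) andbF mulr0 addr0.
have SK c : S (- c)%R *m S c = 1%:M.
  rewrite mulmxDl mul1mx mulmxDr mulmx1 -scalemxAl -scalemxAr.
  by rewrite mul_delta_mx_0// !scaler0 addr0 scaleNr addrK.
have uS c : S c \in unitmx by case: (mulmx1_unit (SK c)).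
rewrite -[A]mul1mx -(SK 1) -mulmxA; apply: scales_mul.
  by apply: (@scales_pivot M) => //; rewrite S00 oner_neq0.
apply: (@scales_pivot M) => //; first by rewrite unitmx_mul uS.
rewrite mulmxDl mul1mx scale1r mxE a0 add0r mxE (bigD1 i)//= big1 ?addr0.
  by rewrite mxE !eqxx mul1r.
by move=> j ji; rewrite mxE (negbTE ji) andbF mul0r.
Qed.

End TupleAffine.

(** * Surface measure *)

Lemma orthogonal_mxr (R : realType) n (A : 'M[R]_n) :
  orthogonal_mx A -> A *m A^T = 1%:M.
Proof. exact: mulmx1C. Qed.

Section Cube.
Variable R : realType.

(** A box containing the unit ball; its finite volume bounds the surface measure. *)
Definition tuple_cube (N : nat) : set (N.-tuple R) :=
  [set x | forall i, tnth x i \in `[-1, 1]].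

Lemma measurable_tuple_cube N : measurable (@tuple_cube N).
Proof.
rewrite (_ : @tuple_cube N =
    \bigcap_(i in [set: 'I_N]) (fun x => tnth x i) @^-1` `[-1, 1]%classic).
  apply: fin_bigcap_measurable => // i _.
  by rewrite -[X in measurable X]setTI; exact: measurable_tnth.
by apply/seteqP; split => x /= xP i; [move=> _; exact: xP|exact: xP i I].
Qed.

Lemma lebesgue_tuple_cube_fin N : (lebesgue_tuple (@tuple_cube N) < +oo)%E.
Proof.
elim: N => [|M IH]; first by rewrite /= diracE ltry.
rewrite /= /pushforward.
rewrite (_ : _ @^-1` _ = `[-1, 1]%classic `*` @tuple_cube M).
  rewrite product_measure1E//; last exact: measurable_tuple_cube.
  rewrite lte_mul_pinfty//.
  rewrite [X in X \is a fin_num](_ : _ = (1 - -1)%:E)//.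
  have := lebesgue_measure_itv `[-1, 1 : R].
  by rewrite /= lte_fin gtrN.
apply/seteqP; split => -[x t] /=.
  by move=> xtP; split=> [|i]; [have := xtP ord0|have := xtP (lift ord0 i)];
    rewrite ?tnth0 ?tnthS.
move=> [xP tP] i; case: (unliftP ord0 i) => [j ->|->]; rewrite ?tnth0 ?tnthS//.
Qed.

End Cube.

Section SurfaceInvariance.
Variables (R : realType) (N : nat).
Implicit Types (A : 'M[R]_N) (x : N.-tuple R).

Lemma tuple_norm_affine A x :
  orthogonal_mx A -> tuple_norm (tuple_affine A 0 x) = tuple_norm x.
Proof.
move=> oA; rewrite /tuple_norm.
have E y : \sum_(i < N) tnth y i ^+ 2 = ((tuple_col y)^T *m tuple_col y) 0 0.
  by rewrite mxE; apply: eq_bigr => i _; rewrite !mxE expr2.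
by rewrite !E tuple_col_affine addr0 trmx_mul mulmxA -(mulmxA _ A^T) oA mulmx1.
Qed.

Lemma radial_proj_affine A x : orthogonal_mx A ->
  radial_proj (tuple_affine A 0 x) = tuple_affine A 0 (radial_proj x).
Proof.
move=> oA.
have E y : tuple_col (radial_proj y) = (tuple_norm y)^-1 *: tuple_col y.
  by apply/colP => i; rewrite !mxE tnth_mktuple mulrC.
apply: tuple_col_inj; rewrite tuple_col_affine !E tuple_col_affine.
by rewrite tuple_norm_affine// !addr0 scalemxAr.
Qed.

Lemma measurable_tuple_norm : measurable_fun setT (@tuple_norm R N).
Proof.
apply: (measurableT_comp (f := @Num.sqrt R)).
  by apply: continuous_measurable_fun; exact: sqrt_continuous.
by apply: measurable_sum => i; apply: measurable_funX; exact: measurable_tnth.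
Qed.

Lemma measurable_radial_proj : measurable_fun setT (@radial_proj R N).
Proof.
apply/measurable_fun_tnthP => i.
(* Inversion becomes the power $-1$, a measurable function that agrees with it on nonnegative
   reals. *)
rewrite (_ : _ \o _ = fun x => tnth x i * tuple_norm x `^ (-1)).
  apply: measurable_funM; first exact: measurable_tnth.
  exact: (measurableT_comp (measurable_powR _) measurable_tuple_norm).
by apply/funext => x /=; rewrite tnth_mktuple powR_inv1 ?sqrtr_ge0.
Qed.

Lemma measurable_sphere : measurable (sphere R N).
Proof.
rewrite (_ : sphere R N = @tuple_norm R N @^-1` [set 1]); last by [].
by rewrite -[X in measurable X]setTI; exact: measurable_tuple_norm.
Qed.

Lemma measurable_punctured_ball : measurable (@punctured_ball R N).
Proof.
rewrite (_ : @punctured_ball R N = @tuple_norm R N @^-1` `]0, 1]%classic).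
  by rewrite -[X in measurable X]setTI; exact: measurable_tuple_norm.
by apply/seteqP; split=> x /=; rewrite in_itv.
Qed.

(** An orthogonal map preserves the punctured ball and commutes with radial projection, so the cone
    over the preimage is the preimage of the cone; its volume is unchanged as $|\det A| = 1$. *)
Lemma surface_measure_orthogonal A (B : set (N.-tuple R)) :
  orthogonal_mx A -> measurable B ->
  surface_measure R N (tuple_affine A 0 @^-1` B) = surface_measure R N B.
Proof.
move=> oA mB; rewrite /surface_measure; congr (_ * _)%E.
have mC : measurable (@radial_proj R N @^-1` B `&` @punctured_ball R N).
  apply: measurableI; last exact: measurable_punctured_ball.
  by rewrite -[X in measurable X]setTI; exact: measurable_radial_proj.
rewrite (_ : _ `&` _ = tuple_affine A 0 @^-1`
    (@radial_proj R N @^-1` B `&` @punctured_ball R N)); last first.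
  apply/seteqP; split => x /=;
  by rewrite radial_proj_affine// /punctured_ball /= tuple_norm_affine.
have [uA _] := mulmx1_unit (orthogonal_mxr oA).
rewrite lebesgue_tuple_affine//.
suff -> : `|\det A| = 1 by rewrite invr1 mul1e.
apply/eqP; rewrite -(@eqrXn2 _ 2)// expr1n -normrX.
by rewrite expr2 -{1}det_tr -det_mulmx oA det1 normr1.
Qed.

(** Change of variables: the pushforward of the surface measure along [A] is the surface measure
    itself, and [A] preserves the sphere. *)
Lemma Rintegral_sphere_orthogonal A (F : N.-tuple R -> R) :
  orthogonal_mx A -> measurable_fun setT F -> (forall x, 0 <= F x) ->
  \int[surface_measure R N]_(x in sphere R N) F (tuple_affine A 0 x) =
  \int[surface_measure R N]_(x in sphere R N) F x.
Proof.
move=> oA mF F0; rewrite /Rintegral; congr fine.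
have mT := @measurable_tuple_affine R N A 0.
pose nu : {measure set (N.-tuple R) -> \bar R} :=
  measure_function_pushforward__canonical__measure_function_Measure
    (surface_measure R N) mT.
transitivity (\int[nu]_(y in sphere R N) (F y)%:E)%E; last first.
  apply: eq_measure_integral => B mB _.
  exact: surface_measure_orthogonal.
rewrite ge0_integral_pushforward//.
- rewrite (_ : _ @^-1` _ = sphere R N)//.
  by apply/seteqP; split => x; rewrite /sphere /= tuple_norm_affine.
- exact: measurable_sphere.
- by apply: measurable_funTS; exact/measurable_EFinP.
- by move=> x _; rewrite lee_fin.
Qed.

Lemma le_tnth_tuple_norm x i : `|tnth x i| <= tuple_norm x.
Proof.
rewrite -sqrtr_sqr ler_wsqrtr// (bigD1 i)//= lerDl.
by apply: sumr_ge0 => j _; exact: sqr_ge0.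
Qed.

Lemma surface_measure_fin (B : set (N.-tuple R)) :
  measurable B -> (surface_measure R N B < +oo)%E.
Proof.
move=> mB; rewrite /surface_measure lte_mul_pinfty//.
apply: le_lt_trans (lebesgue_tuple_cube_fin R N).
apply: le_measure; rewrite ?inE.
- apply: measurableI; last exact: measurable_punctured_ball.
  by rewrite -[X in measurable X]setTI; exact: measurable_radial_proj.
- exact: measurable_tuple_cube.
- move=> x [_ /= /andP[_ x1]] i; rewrite in_itv /= -ler_norml.
  exact: le_trans (le_tnth_tuple_norm x i) x1.
Qed.

Lemma measurable_meval (p : mpoly N R) :
  measurable_fun setT (fun x : N.-tuple R => meval (tnth x) p).
Proof.
under eq_fun do rewrite mevalE.
apply: measurable_sum => m; apply: measurable_funM => //.
apply: measurable_prod => i _; apply: measurable_funX; exact: measurable_tnth.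
Qed.

Lemma integrable_meval_sphere (p : mpoly N R) :
  (surface_measure R N).-integrable (sphere R N)
    (EFin \o (fun x => meval (tnth x) p)).
Proof.
apply: measurable_bounded_integrable.
- exact: measurable_sphere.
- by apply: surface_measure_fin; exact: measurable_sphere.
- by apply: measurable_funTS; exact: measurable_meval.
(* On the sphere all coordinates, hence all monomials, are at most 1 in absolute value. *)
- exists (\sum_(m <- msupp p) `|mcoeff m p|); split; first exact: num_real.
  move=> y /ltW py x /= xS; apply: le_trans py.
  rewrite mevalE; apply: le_trans (ler_norm_sum _ _ _) _.
  apply: ler_sum => m _; rewrite normrM ler_piMr// normr_prod.
  apply: prodr_ile1 => i _; rewrite normr_ge0 normrX exprn_ile1//.
  by rewrite -xS; exact: le_tnth_tuple_norm.
Qed.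

Definition sphere_integral (p : mpoly N R) : R :=
  \int[surface_measure R N]_(x in sphere R N) meval (tnth x) p.

Lemma sphere_integralZ c p :
  sphere_integral (c *: p) = c * sphere_integral p.
Proof.
rewrite /sphere_integral -RintegralZl.
- by apply: eq_Rintegral => x _; rewrite mevalZ.
- exact: measurable_sphere.
- exact: integrable_meval_sphere.
Qed.

Lemma sphere_integral_sum I (r : seq I) (F : I -> mpoly N R) :
  sphere_integral (\sum_(i <- r) F i) = \sum_(i <- r) sphere_integral (F i).
Proof.
apply: (big_morph sphere_integral).
  move=> p q; rewrite /sphere_integral -RintegralD.
  - by apply: eq_Rintegral => x _; rewrite mevalD.
  - exact: measurable_sphere.
  - exact: integrable_meval_sphere.
  - exact: integrable_meval_sphere.
by rewrite -(scale0r 0) sphere_integralZ mul0r.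
Qed.

End SurfaceInvariance.

(** * Linear substitution and homogenization *)

Section LinearAction.
Variables (R : realType) (n : nat).
Implicit Types (A B : 'M[R]_n) (p f : mpoly n R).
Local Notation msize p := (mpoly.msize p).
Local Notation var i := (mpolyX R (mnm1 i)).

(** The order reverses because [A] is applied to the point first: $x \mapsto p(B(Ax))$. *)
Lemma lin_actM A B p : lin_act A (lin_act B p) = lin_act (B *m A) p.
Proof.
rewrite [lin_act B p]comp_mpolyE [RHS]comp_mpolyE /lin_act raddf_sum.
apply: eq_bigr => m _; rewrite /= comp_mpolyZ rmorph_prod; congr (_ *: _).
apply: eq_bigr => i _; rewrite /= rmorphXn; congr (_ ^+ _).
rewrite !tnth_mktuple raddf_sum /=.
under eq_bigr do rewrite comp_mpolyZ comp_mpolyXU -tnth_nth tnth_mktuple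
  scaler_sumr.
rewrite exchange_big; apply: eq_bigr => k _ /=; rewrite mxE scaler_suml.
by apply: eq_bigr => j _; rewrite scalerA.
Qed.

Lemma lin_act1 p : lin_act 1%:M p = p.
Proof.
rewrite -[RHS]comp_mpoly_id /lin_act; congr comp_mpoly.
apply: eq_from_tnth => i; rewrite !tnth_mktuple (bigD1 i)//= mxE eqxx scale1r.
rewrite big1 ?addr0// => j ji; by rewrite mxE eq_sym (negbTE ji) scale0r.
Qed.

(** Stated as a degree bound, [msize] being one more than the degree, so that zero factors are
    covered. *)
Lemma msizeM_leq p (q : mpoly n R) a b :
  (msize p <= a.+1)%N -> (msize q <= b.+1)%N -> (msize (p * q) <= (a + b).+1)%N.
Proof.
have [->|p0] := eqVneq p 0; first by rewrite mul0r msize0.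
have [->|q0] := eqVneq q 0; first by rewrite mulr0 msize0.
move=> pa qb; rewrite msizeM// -subn1 leq_subLR add1n -addnS -addSn.
exact: leq_add.
Qed.

Lemma msize_lin_act A p : (msize (lin_act A p) <= msize p)%N.
Proof.
rewrite [lin_act A p]comp_mpolyE (leq_trans (msize_sum _ _ _))//.
apply/bigmax_leqP_seq => m mp _; apply: leq_trans (msize_mdeg_lt mp).
apply: leq_trans (msizeZ_le _ _) _; rewrite mdegE.
elim/big_rec2: _ => [|i k q _ IH]; first by rewrite msize1.
apply: msizeM_leq => //; elim: (m i) => [|e IHe]; first by rewrite expr0 msize1.
rewrite exprS; apply: (@msizeM_leq _ _ 1 e) => //.
rewrite tnth_mktuple (leq_trans (msize_sum _ _ _))//.
by apply/bigmax_leqP => j _; rewrite (leq_trans (msizeZ_le _ _))// msizeX mdeg1.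
Qed.

(** A linear substitution cannot raise the degree, and neither can its inverse. *)
Lemma mdegree_lin_act A p : A \in unitmx -> mdegree (lin_act A p) = mdegree p.
Proof.
move=> uA; congr (_.-1); apply/eqP; rewrite eqn_leq msize_lin_act /=.
by rewrite -{1}[p]lin_act1 -(mulmxV uA) -lin_actM msize_lin_act.
Qed.

(** The numbers $1, \dots, $ [size q] are distinct roots, too many for a nonzero polynomial. *)
Lemma poly_eq0_off0 (q : {poly R}) : (forall s, s != 0 -> q.[s] = 0) -> q = 0.
Proof.
move=> q0; apply: (@roots_geq_poly_eq0 _ _ [seq (i.+1)%:R | i <- iota 0 (size q)]).
- by apply/allP => _ /mapP[i _ ->]; rewrite /root q0 ?pnatr_eq0.
- rewrite map_inj_uniq ?iota_uniq// => i j /eqP.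
  by rewrite eqr_nat => /eqP[].
- by rewrite size_map size_iota.
Qed.

(* On the hyperplane at infinity homogenizeE is void: there the two sides, which
   are polynomials in the last coordinate, agree because they agree off 0. *)
Lemma homogenize_lin_act A p (x : 'cV[R]_(n + 1)) : A \in unitmx ->
  meval (fun i => x i 0) (homogenize (lin_act A p)) =
  meval (fun i => (block_mx A 0 0 1%:M *m x) i 0) (homogenize p).
Proof.
move=> uA.
pose pt (y : 'cV[R]_n) s : 'cV[R]_(n + 1) := col_mx y s%:M.
have ptE : x = pt (usubmx x) (dsubmx x 0 0) by rewrite /pt -mx11_scalar vsubmxK.
have actE y s : block_mx A 0 0 1%:M *m pt y s = pt (A *m y) s.
  by rewrite mul_block_col !mul0mx addr0 add0r mul1mx.
(* Restriction of [q] to the points with first coordinates [y], as a univariate polynomial in the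
   homogenizing variable. *)
pose line (y : 'cV[R]_n) (q : mpoly (n + 1) R) : {poly R} :=
  mmap polyC (fun i => if fintype.split i is inl j then (y j 0)%:P else 'X) q.
have lineE y s q : (line y q).[s] = meval (fun i => pt y s i 0) q.
  rewrite mevalE [line y q]/mmap horner_sum; apply: eq_bigr => m _.
  rewrite hornerM hornerC horner_prod; congr (_ * _); apply: eq_bigr => i _.
  rewrite horner_exp; congr (_ ^+ _).
  case: split_ordP => j ->; first by rewrite hornerC col_mxEu.
  by rewrite hornerX col_mxEd mxE ord1 eqxx mulr1n.
rewrite ptE actE -!lineE; congr (_.[_]); apply/eqP; rewrite -subr_eq0.
set y := usubmx x; apply/eqP/poly_eq0_off0 => s s0.
have ptl z : pt z s (rshift n ord0) 0 = s.
  by rewrite col_mxEd mxE eqxx mulr1n.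
(* Both sides carry the same power of [s] because an invertible substitution preserves the
   degree. *)
rewrite hornerD hornerN !lineE !homogenizeE ?ptl// mdegree_lin_act//.
apply/eqP; rewrite subr_eq0; apply/eqP; congr (_ * _).
transitivity (meval (fun i => (s^-1 *: y) i 0) (lin_act A p)).
  by apply: meval_eq => i; rewrite col_mxEu [RHS]mxE mulrC.
by rewrite lin_actE; apply: meval_eq => i; rewrite -scalemxAr col_mxEu [LHS]mxE mulrC.
Qed.

End LinearAction.

(** * Principal axes *)

Section PrincipalAxesUniqueness.
Variables (R : realType) (n : nat).
Implicit Types (f : mpoly n R) (u v w : 'cV[R]_n) (A V : 'M[R]_n).

Lemma orthogonal_block_mx A :
  orthogonal_mx A -> orthogonal_mx (block_mx A 0 0 (1%:M : 'M[R]_1)).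
Proof.
move=> oA; rewrite /orthogonal_mx tr_block_mx !trmx0 trmx1 mulmx_block oA.
by rewrite !(mulmx0, mul0mx, mulmx1) !addr0 add0r -scalar_mx_block.
Qed.

(** Extend [A] to [A'] fixing the homogenizing variable. Then $[Au,0]^\top A'x = [u,0]^\top x$, and
    rotation invariance under [A'] applies. *)
Lemma axis_var_lin_act A f u : orthogonal_mx A ->
  axis_var (lin_act A f) u = axis_var f (A *m u).
Proof.
move=> oA; have oA' := orthogonal_block_mx oA.
have [uA _] := mulmx1_unit (orthogonal_mxr oA).
set A' := block_mx _ _ _ _ in oA'.
rewrite /axis_var /pw_var -[RHS](Rintegral_sphere_orthogonal oA').
- apply: eq_Rintegral => x _.
  have colE y : tnth y =1 (fun i => (@tuple_col R (n + 1) y) i 0).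
    by move=> i; rewrite mxE.
  have dotE (w : 'cV[R]_(n + 1)) (y : (n + 1).-tuple R) :
      \sum_i w i 0 * tnth y i = (w^T *m tuple_col y) 0 0.
    by rewrite mxE; apply: eq_bigr => i _; rewrite !mxE.
  congr (_ ^+ 2 * _ ^+ 2).
    rewrite !(meval_eq _ (colE _)) homogenize_lin_act// tuple_col_affine.
    by rewrite addr0.
  rewrite !dotE tuple_col_affine addr0.
  rewrite (_ : col_mx (A *m u) 0 = A' *m col_mx u 0).
    by rewrite trmx_mul mulmxA -(mulmxA _ A'^T) oA' mulmx1.
  by rewrite mul_block_col !mulmx0 mul0mx !addr0.
- apply: measurable_funM; apply: measurable_funX; first exact: measurable_meval.
  apply: measurable_sum => i; apply: measurable_funM => //.
  exact: measurable_tnth.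
- by move=> x; rewrite mulr_ge0 ?sqr_ge0.
Qed.

(** [Q] is the matrix of moments $\int \overline f^2 x_i x_j \, d\mu$, obtained by expanding the
    square of the linear weight. *)
Lemma axis_var_quadratic f : exists2 Q : 'M[R]_n,
  Q^T = Q & forall u, axis_var f u = (u^T *m Q *m u) 0 0.
Proof.
pose X i : mpoly (n + 1) R := mpolyX R (mnm1 (lshift 1 i)).
pose h := homogenize f.
exists (\matrix_(i, j) sphere_integral (h ^+ 2 * (X i * X j))).
  by apply/matrixP => i j; rewrite !mxE (mulrC (X i)).
move=> u.
transitivity (sphere_integral (h ^+ 2 * (\sum_i u i 0 *: X i) ^+ 2)).
  apply: eq_Rintegral => x _.
  rewrite mevalM !rmorphXn /=; congr (_ * _ ^+ 2).
  rewrite big_split_ord /= [X in _ + X]big1 ?addr0.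
    by rewrite raddf_sum; apply: eq_bigr => i _ /=; rewrite col_mxEu mevalZ mevalXU.
  by move=> i _; rewrite col_mxEd mxE mul0r.
rewrite [X in _ * X]expr2 mulr_suml mulr_sumr sphere_integral_sum.
rewrite -mulmxA mxE; apply: eq_bigr => i _; rewrite !mxE.
rewrite [X in sphere_integral (_ * X)]mulr_sumr [X in sphere_integral X]mulr_sumr.
rewrite sphere_integral_sum mulr_sumr; apply: eq_bigr => j _.
rewrite -scalerAl -scalerAr -!scalerAr !sphere_integralZ !mxE.
by rewrite -[RHS]/(_ * _) [RHS]mulrC mulrA.
Qed.

Lemma dotvE u v : dotv u v = (u^T *m v) 0 0.
Proof. by rewrite mxE; apply: eq_bigr => i _; rewrite mxE. Qed.

Lemma dotvC u v : dotv u v = dotv v u.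
Proof. by apply: eq_bigr => i _; rewrite mulrC. Qed.

Lemma dotvDl u v w : dotv (u + v) w = dotv u w + dotv v w.
Proof. by rewrite !dotvE linearD /= mulmxDl mxE. Qed.

Lemma dotvZl c u v : dotv (c *: u) v = c * dotv u v.
Proof. by rewrite !dotvE linearZ /= -scalemxAl mxE. Qed.

Lemma dotvDr u v w : dotv u (v + w) = dotv u v + dotv u w.
Proof. by rewrite dotvC dotvDl !(dotvC u). Qed.

Lemma dotvZr c u v : dotv u (c *: v) = c * dotv u v.
Proof. by rewrite dotvC dotvZl (dotvC u). Qed.

Lemma dotv_ge0 u : 0 <= dotv u u.
Proof. by apply: sumr_ge0 => i _; rewrite -expr2 sqr_ge0. Qed.

Lemma dotv_eq0 u : dotv u u = 0 -> u = 0.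
Proof.
move=> /eqP; rewrite psumr_eq0 => [|i _]; last by rewrite -expr2 sqr_ge0.
move=> /allP u0; apply/colP => i; rewrite mxE; apply/eqP.
by have /= := u0 i (mem_index_enum _); rewrite -expr2 sqrf_eq0.
Qed.

Lemma dotv_col A V i j : dotv (col i A) (col j V) = (A^T *m V) i j.
Proof. by rewrite mxE; apply: eq_bigr => k _; rewrite !mxE. Qed.

Lemma principal_axes_orthogonal f V :
  principal_axes f (fun i => col i V) -> orthogonal_mx V.
Proof.
move=> pV; apply/matrixP => i j; rewrite -dotv_col mxE.
have [->|ij] := eqVneq i j.
  have [[nj _] _] := pV j; rewrite -[LHS]sqr_sqrtr ?dotv_ge0//.
  by rewrite -/(vnorm _) nj expr1n.
have [lt|lt|/val_inj e] := ltngtP i j; last by rewrite e eqxx in ij.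
  by rewrite dotvC; have [[_ ->]] := pV j.
by have [[_ ->]] := pV i.
Qed.

(** Maximality without normalization: the variance is homogeneous of degree 2, so a nonzero [w] may
    be scaled to norm 1. *)
Lemma axis_var_le f V (i : 'I_n) w : principal_axes f (fun i => col i V) ->
  (forall j : 'I_n, (j < i)%N -> dotv w (col j V) = 0) ->
  axis_var f w <= axis_var f (col i V) * dotv w w.
Proof.
move=> pV w0; have [Q _ qE] := axis_var_quadratic f.
have qZ c u : axis_var f (c *: u) = c ^+ 2 * axis_var f u.
  by rewrite !qE -!mulmxA -!dotvE -scalemxAr dotvZl dotvZr mulrA expr2.
have [/dotv_eq0 ->|dw] := eqVneq (dotv w w) 0.
  by rewrite -(scale0r (0 : 'cV[R]_n)) qZ dotvZl expr0n !mul0r mulr0.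
have dw0 : 0 < dotv w w by rewrite lt_def dw dotv_ge0.
have n0 : 0 < vnorm w by rewrite sqrtr_gt0.
have n2 : vnorm w ^+ 2 = dotv w w by rewrite sqr_sqrtr ?dotv_ge0.
have [_ /(_ ((vnorm w)^-1 *: w))] := pV i.
rewrite qZ exprVn n2 mulrC ler_pdivrMr//; apply; split.
  by rewrite /vnorm dotvZl dotvZr mulrA -expr2 exprVn n2 mulVf// sqrtr1.
by move=> j ji; rewrite dotvZl w0// mulr0.
Qed.

(* First-order optimality: perturbing [v_i] in the admissible direction [v_j]
   cannot increase the variance, so their mixed term vanishes. *)
Lemma principal_axes_diag f V (Q : 'M[R]_n) :
  Q^T = Q -> (forall u, axis_var f u = (u^T *m Q *m u) 0 0) ->
  principal_axes f (fun i => col i V) ->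
  V^T *m Q *m V = diag_mx (\row_i axis_var f (col i V)).
Proof.
move=> Qs qE pV; have oV := principal_axes_orthogonal pV.
set D := V^T *m Q *m V.
have DE i j : D i j = dotv (col i V) (Q *m col j V).
  have -> : Q *m col j V = col j (Q *m V) by rewrite !colE mulmxA.
  by rewrite dotv_col mulmxA.
have Ds i j : D i j = D j i.
  have DT : D^T = D by rewrite /D !trmx_mul trmxK Qs mulmxA.
  by rewrite -{1}DT mxE.
have qD u : axis_var f u = dotv u (Q *m u) by rewrite qE dotvE mulmxA.
have dE (k l : 'I_n) : dotv (col k V) (col l V) = (k == l)%:R.
  by rewrite dotv_col oV mxE.
have off (i j : 'I_n) : (i < j)%N -> D i j = 0.
  move=> ij; have ijF : (i == j) = false by apply/eqP => e; rewrite e ltnn in ij.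
  pose li := axis_var f (col i V); pose lj := axis_var f (col j V).
  (* Compare [axis_var_le] at $v_i + e v_j$, admissible since $i < j$: the variance is $l_i +
     2eD_{ij} + e^2 l_j$ and the squared norm $1 + e^2$. *)
  have le e : 2 * e * D i j <= e ^+ 2 * (li - lj).
    have w0 (k : 'I_n) : (k < i)%N -> dotv (col i V + e *: col j V) (col k V) = 0.
      move=> ki; rewrite dotvDl dotvZl !dE.
      case: eqP => [e1|_]; first by rewrite e1 ltnn in ki.
      case: eqP => [e1|_]; last by rewrite mulr0 addr0.
      by have := ltn_trans ki ij; rewrite e1 ltnn.
    have := axis_var_le pV w0.
    rewrite qD mulmxDr -scalemxAr !(dotvDl, dotvDr, dotvZl, dotvZr) -!DE !dE.
    rewrite (eq_sym j) ijF !eqxx (Ds j i).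
    have -> : D i i = li by rewrite /li qD DE.
    have -> : D j j = lj by rewrite /lj qD DE.
    by rewrite -/li /= !mulr1n !mulr0n; lra.
  (* Adding [le 1] and [le (-1)] gives [lj <= li], whence [K > 0]. With $D_{ij} = eK$, the bound
     [le e] becomes $e^2(K+1) \le 0$. *)
  pose K := li - lj + 1.
  have K0 : 0 < K by have := le 1; have := le (-1); rewrite /K; lra.
  pose e := D i j / K; have eK : D i j = e * K by rewrite divfK ?gt_eqF.
  suff e0 : e = 0 by rewrite eK e0 mul0r.
  have := le e; rewrite eK => leK.
  have : e ^+ 2 * (K + 1) <= 0 by move: leK; rewrite /K; lra.
  have K1 : 0 < K + 1 by rewrite addr_gt0.
  by rewrite (pmulr_lle0 _ K1) => e2; apply/eqP; rewrite -sqrf_eq0 eq_le e2 sqr_ge0.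
apply/matrixP => i j; rewrite [RHS]mxE [X in X *+ _]mxE.
have [<-|ij] := eqVneq i j; first by rewrite mulr1n DE qD.
have [lt|lt|/val_inj e] := ltngtP i j; last by rewrite e eqxx in ij.
  by rewrite off.
by rewrite Ds off.
Qed.

(** * Uniqueness up to signs *)

Lemma signs_sqr (s : 'rV[R]_n) : is_signs s <-> forall i, s 0 i ^+ 2 = 1.
Proof.
split=> sP i; first by case: (sP i) => ->; rewrite ?sqrrN expr1n.
by have /eqP := sP i; rewrite sqrf_eq1 => /orP[]/eqP; [left|right].
Qed.

Lemma diag_signs_sqr (s : 'rV[R]_n) :
  is_signs s -> diag_mx s *m diag_mx s = 1%:M.
Proof.
move=> /signs_sqr sP; rewrite mulmx_diag -diag_const_mx; congr diag_mx.
by apply/rowP => i; rewrite !mxE -expr2.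
Qed.

Lemma orthogonalM A V : orthogonal_mx A -> orthogonal_mx V ->
  orthogonal_mx (A *m V).
Proof.
move=> oA oV; rewrite /orthogonal_mx trmx_mul mulmxA -(mulmxA V^T) oA mulmx1.
exact: oV.
Qed.

(* By induction on [i], [v_i] is [v0_i] up to sign: it is a combination of the
   [v0_k] with [k >= i], and among these only [v0_i] and [- v0_i] reach the
   variance [lambda0 i], the other eigenvalues being smaller. *)
Lemma pwpca_unique f (lambda0 lambda : 'rV[R]_n) V0 V :
  is_pwpca f lambda0 V0 ->
  (forall i j : 'I_n, (i < j)%N -> lambda0 0 j < lambda0 0 i) ->
  is_pwpca f lambda V ->
  lambda0 = lambda /\ exists2 s, is_signs s & V = V0 *m diag_mx s.
Proof.
move=> [p0 l0] lt0 [pV lV].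
have o0 := principal_axes_orthogonal p0; have oV := principal_axes_orthogonal pV.
have [Q Qs qE] := axis_var_quadratic f.
(* Column [i] of [C] holds the coordinates of $v_i$ in the eigenbasis [V0]; the goal is that [C] is
   diagonal with entries $\pm 1$. *)
pose C := V0^T *m V.
have VE : V = V0 *m C by rewrite mulmxA orthogonal_mxr// mul1mx.
have oC i j : \sum_k C k i * C k j = (i == j)%:R.
  have oC : orthogonal_mx C.
    by apply: orthogonalM => //; rewrite /orthogonal_mx trmxK orthogonal_mxr.
  have /matrixP/(_ i j) := oC; rewrite !mxE => <-.
  by apply: eq_bigr => k _; rewrite !mxE.
have varE i : axis_var f (col i V) = \sum_k lambda0 0 k * C k i ^+ 2.
  rewrite qE VE (_ : col i _ = V0 *m col i C); last by rewrite !colE mulmxA.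
  rewrite trmx_mul !mulmxA -[_ *m V0^T *m Q *m V0]mulmxA -[_ *m V0^T *m _]mulmxA.
  rewrite [V0^T *m _]mulmxA (principal_axes_diag Qs qE p0) mul_mx_diag mxE.
  by apply: eq_bigr => k _; rewrite !mxE -l0 expr2; ring.
have sqC i : (forall k, k != i -> C k i = 0) -> C i i ^+ 2 = 1.
  move=> Ci; have := oC i i; rewrite eqxx (bigD1 i)//= big1 ?addr0 => [//|k ki].
  by rewrite Ci ?mul0r.
have diagC m : forall i : 'I_n, (i < m)%N -> forall k, k != i -> C k i = 0.
  elim: m => [//|m IH] i; rewrite ltnS => im.
  have {}IH (j : 'I_n) : (j < i)%N -> forall k, k != j -> C k j = 0.
    by move=> ji; apply: IH; exact: leq_trans ji im.
  (* Column [j] of [C] is already $\pm e_j$, and column [i] is orthogonal to it. *)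
  have low (j : 'I_n) : (j < i)%N -> C j i = 0.
    move=> ji; have := oC j i; rewrite -val_eqE /= ltn_eqF// (bigD1 j)//= big1.
      rewrite addr0 => /eqP; rewrite mulf_eq0 => /orP[/eqP Cjj|/eqP//].
      have := sqC _ (IH j ji); rewrite Cjj expr0n => /eqP.
      by rewrite eq_sym oner_eq0.
    by move=> k kj; rewrite IH// mul0r.
  (* Column [i] of [V0] competes with $v_i$: the earlier columns of [V] are multiples of those of
     [V0], so it is orthogonal to them. *)
  have le : lambda0 0 i <= \sum_k lambda0 0 k * C k i ^+ 2.
    rewrite -varE l0; have [_] := pV i; apply; split.
      by have [[]] := p0 i.
    move=> j ji; rewrite dotv_col; apply: IH => //.
    by rewrite -val_eqE /= gtn_eqF.
  have ge0 k : 0 <= (lambda0 0 i - lambda0 0 k) * C k i ^+ 2.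
    have [ki|ki|/val_inj ->] := ltngtP k i; last by rewrite subrr mul0r.
      by rewrite low// expr0n mulr0.
    by rewrite mulr_ge0 ?sqr_ge0// subr_ge0 ltW// lt0.
  (* As column [i] of [C] has norm 1, this sum is [lambda0 0 i] minus the variance along $v_i$,
     nonpositive by [le]; its terms are nonnegative. *)
  have sum0 : \sum_k (lambda0 0 i - lambda0 0 k) * C k i ^+ 2 == 0.
    rewrite eq_le sumr_ge0// andbT.
    under eq_bigr do rewrite mulrBl.
    rewrite sumrB -mulr_sumr; under eq_bigr do rewrite expr2.
    by rewrite oC eqxx mulr1 subr_le0.
  move=> k ki; have [lt|lt|/val_inj e] := ltngtP k i; first exact: low.
    move: sum0; rewrite psumr_eq0// => /allP/(_ k (mem_index_enum _)) /=.
    rewrite mulf_eq0 sqrf_eq0 subr_eq0 gt_eqF ?lt0//=.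
    by move/eqP.
  by rewrite e eqxx in ki.
have {}diagC i k : k != i -> C k i = 0 by exact: (diagC n).
split.
  apply/rowP => i; rewrite lV varE (bigD1 i)//= big1 ?addr0.
    by rewrite sqC ?mulr1// => k; exact: diagC.
  by move=> k ki; rewrite diagC// expr0n mulr0.
exists (\row_i C i i).
  by apply/signs_sqr => i; rewrite mxE; apply: sqC => k; exact: diagC.
rewrite VE; congr (_ *m _); apply/matrixP => i j; rewrite [RHS]mxE [X in X *+ _]mxE.
have [->|ij] := eqVneq i j; first by rewrite mulr1n.
exact: diagC.
Qed.

(** Distinctness is witnessed by some PW-PCA; both given ones are compared with it, and the two sign
    vectors multiply. *)
Lemma pwpca_signs f (lambda lambda' : 'rV[R]_n) V V' :
  distinct_principal_variances f -> is_pwpca f lambda V ->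
  is_pwpca f lambda' V' ->
  lambda = lambda' /\ exists2 s, is_signs s & V' = V *m diag_mx s.
Proof.
move=> [l0 [V0 [p0 lt0]]] p p'.
have [<- [s sP ->]] := pwpca_unique p0 lt0 p.
have [<- [s' sP' ->]] := pwpca_unique p0 lt0 p'.
split=> //; exists (\row_i (s 0 i * s' 0 i)).
  apply/signs_sqr => i; rewrite mxE exprMn.
  by rewrite (signs_sqr s).1// (signs_sqr s').1// mulr1.
rewrite -mulmx_diag -!mulmxA [diag_mx s *m (_ *m _)]mulmxA.
by rewrite diag_signs_sqr// mul1mx.
Qed.

(** [A] is an isometry that matches the two variances, so candidates correspond: a competitor [u]
    for [f] is pulled back to [A^T *m u]. *)
Lemma is_pwpca_lin_act f A (lambda : 'rV[R]_n) V : orthogonal_mx A ->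
  is_pwpca (lin_act A f) lambda V -> is_pwpca f lambda (A *m V).
Proof.
move=> oA [pV lV].
have cE i : col i (A *m V) = A *m col i V by rewrite !colE mulmxA.
have dA u v : dotv u (A *m v) = dotv (A^T *m u) v.
  by rewrite !dotvE trmx_mul trmxK mulmxA.
have dAA u v : dotv (A *m u) (A *m v) = dotv u v.
  by rewrite dA mulmxA oA mul1mx.
split=> [i|i]; last by rewrite lV axis_var_lin_act// cE.
have [[ni oi] maxi] := pV i; split.
  split; first by rewrite cE /vnorm dAA.
  by move=> j ji; rewrite !cE dAA oi.
move=> u [nu ou]; have oA' := orthogonal_mxr oA.
rewrite cE -axis_var_lin_act// -[u]mul1mx -oA' -mulmxA -axis_var_lin_act//.
apply: maxi; split.
  by rewrite /vnorm -dA mulmxA oA' mul1mx.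
by move=> j ji; rewrite -dA -cE ou.
Qed.

End PrincipalAxesUniqueness.

(** * Orthogonal equivalence reduced to sign flips *)

Theorem theorem17 (R : realType) (n : nat) (f g : mpoly n R)
    (hf : distinct_principal_variances f) (hg : distinct_principal_variances g)
    (lambda_f lambda_g : 'rV[R]_n) (Vf Vg : 'M[R]_n)
    (pcaf : is_pwpca f lambda_f Vf) (pcag : is_pwpca g lambda_g Vg) :
  let f_hat := lin_act Vf f in
  let g_hat := lin_act Vg g in
  [/\ sim_orth f g -> lambda_f = lambda_g,
      sim_orth f g <-> sim_sign f_hat g_hat &
      forall s : 'rV[R]_n, is_signs s -> lin_act (diag_mx s) f_hat = g_hat ->
        lin_act (Vf *m diag_mx s *m Vg^T) f = g].
Proof.
move=> f_hat g_hat.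
have oVf := principal_axes_orthogonal pcaf.1.
have oVg := principal_axes_orthogonal pcag.1.
(* If $g = A \bullet f$, then $AV_g$ gives principal axes of [f], so $AV_g = V_f
   \operatorname{diag}(s)$; acting on [f] with both sides relates [g_hat] to [f_hat]. *)
have orth_signs : sim_orth f g -> lambda_f = lambda_g /\
    exists2 s, is_signs s & g_hat = lin_act (diag_mx s) f_hat.
  move=> [A oA gE]; move: pcag; rewrite gE => /(is_pwpca_lin_act oA) pcaA.
  have [le [s sP AVg]] := pwpca_signs hf pcaf pcaA.
  by split=> //; exists s; rewrite // /g_hat /f_hat gE !lin_actM AVg.
(* Acting successively with $V_f$, $\operatorname{diag}(s)$ and $V_g^\top$ takes [f] to [f_hat],
   [g_hat] and finally [g]. *)
have signs_orth s : lin_act (diag_mx s) f_hat = g_hat ->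
    lin_act (Vf *m diag_mx s *m Vg^T) f = g.
  move=> sE; rewrite -lin_actM -lin_actM -/f_hat sE lin_actM.
  by rewrite orthogonal_mxr// lin_act1.
split=> [/orth_signs[]//| |s _]; last exact: signs_orth.
split=> [/orth_signs[]//|[s sP sE]].
exists (Vf *m diag_mx s *m Vg^T); last by rewrite signs_orth.
apply: orthogonalM; last by rewrite /orthogonal_mx trmxK orthogonal_mxr.
by apply: orthogonalM => //; rewrite /orthogonal_mx tr_diag_mx diag_signs_sqr.
Qed.
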